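(* Let $A(z)$ and $B(z)$ be meromorphic functions on $\mathbb{C}$ that are periodic of period $1$, and suppose that the difference equation $$(\Delta f(z))^2=A(z)\bigl(f(z)f(z+1)-B(z)\bigr)$$ possesses two distinct transcendental meromorphic solutions $f_1(z)$ and $f_2(z)$ such that $f_j(z+2)\not\equiv f_j(z)$ for $j=1,2$. Then the Casoratian $$H(z)=f_1(z)\Delta f_2(z)-f_2(z)\Delta f_1(z)$$ is a periodic function of period $1$, and $f_1(z)$ and $f_2(z)$ satisfy the algebraic relation $$A(z)\Bigl((A(z)+4)f_1(z)^2f_2(z)^2-2B(z)\bigl(f_1(z)^2+f_2(z)^2\bigr)\Bigr)H(z)^2-\Bigl(A(z)B(z)\bigl(f_1(z)^2-f_2(z)^2\bigr)\Bigr)^2=H(z)^4,$$ whose coefficients are periodic functions of period $1$.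
   Context: ''Meromorphic'' means meromorphic in the whole complex plane $\mathbb{C}$. The difference operator is $\Delta f(z)=f(z+1)-f(z)$. A function $g$ is called periodic of period $p$ if $g(z+p)=g(z)$ identically (so constants are included, and $p$ need not be the minimal period). A meromorphic function is transcendental if it is not rational. *)

(* Defs.v *)
From Stdlib Require Import Reals List.
From Coquelicot Require Import Coquelicot.
Open Scope C_scope.

(** A meromorphic function on the plane is represented by a total function
    [C -> C] whose values on a closed discrete set (in particular at the poles)
    carry no information. *)

(** Laurent expansion with finite principal part: near [z0], off [z0] itself,
    [(z - z0)^n * f z] is the sum of a convergent power series in [z - z0]. *)
Definition meromorphic_at (f : C -> C) (z0 : C) : Prop :=
  exists (n : nat) (a : nat -> C),
    locally' z0 (fun z : C => is_pseries a (z - z0) ((z - z0) ^ n * f z)).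

Definition meromorphic (f : C -> C) : Prop := forall z0 : C, meromorphic_at f z0.

(** Identity of meromorphic functions: the two sides agree off a closed discrete
    set.  Pointwise equality of the representatives would be too strong, since
    the values at poles are arbitrary. *)
Definition mero_eq (f g : C -> C) : Prop :=
  forall z0 : C, locally' z0 (fun z : C => f z = g z).

Definition periodic (p : C) (g : C -> C) : Prop :=
  mero_eq (fun z => g (z + p)) g.

(** Coefficients are listed from the constant term upwards. *)
Definition Cpoly_eval (c : list C) (z : C) : C :=
  fold_right (fun a s => a + z * s) (RtoC 0) c.

Definition rational (f : C -> C) : Prop :=
  exists p q : list C,
    (exists z : C, Cpoly_eval q z <> 0) /\
    mero_eq f (fun z => Cpoly_eval p z / Cpoly_eval q z).

Definition transcendental (f : C -> C) : Prop := ~ rational f.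

Definition Delta (f : C -> C) : C -> C := fun z => f (z + 1) - f z.

Definition casoratian (f1 f2 : C -> C) : C -> C :=
  fun z => f1 z * Delta f2 z - f2 z * Delta f1 z.

Definition solution (A B f : C -> C) : Prop :=
  mero_eq (fun z => (Delta f z) ^ 2)
          (fun z => A z * (f z * f (z + 1) - B z)).

(* Main.v *)
(** Subtracting the equation from its shift gives
    [(f(z+2) - f(z)) (f(z+2) - (A(z)+2) f(z+1) + f(z)) = 0].  A meromorphic
    function which is not identically zero has isolated zeros, by the local
    expansion and the connectedness of the plane, so the assumption on the
    first factor forces the linear equation [f(z+2) = (A(z)+2) f(z+1) - f(z)].
    Its Casoratian is periodic.  The algebraic relation follows by eliminating
    [f1(z+1)] and [f2(z+1)] from the two equations and the definition of [H]. *)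

Require Import Defs.
From Stdlib Require Import Reals List Arith Lra Lia Psatz Classical.
From Coquelicot Require Import Coquelicot.
Open Scope C_scope.

(** * Punctured neighbourhoods and connectedness of the plane *)

Lemma Cminus_eq_0 (x y : C) : x - y = 0 -> x = y.
Proof. intros E. rewrite <- (Cplus_0_r y), <- E. ring. Qed.

Lemma locally_Cmod (z0 : C) (P : C -> Prop) :
  @locally C_UniformSpace z0 P <->
  exists r : R, (0 < r)%R /\ forall z, (Cmod (z - z0) < r)%R -> P z.
Proof.
  refine (iff_trans (locally_C z0 P) _). split.
  - intros [e He]. exists e. split; [apply cond_pos|]. exact He.
  - intros [r [Hr H]]. exists (mkposreal r Hr). exact H.
Qed.

Lemma locally'_Cmod (z0 : C) (P : C -> Prop) :
  locally' z0 P <->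
  exists r : R,
    (0 < r)%R /\ forall z, (0 < Cmod (z - z0) < r)%R -> P z.
Proof.
  unfold locally', within. rewrite locally_Cmod.
  split; intros [r [Hr H]]; exists r; split; trivial; intros z Hz.
  - apply H; [tauto|]. intros ->.
    replace (z0 - z0) with (RtoC 0) in Hz by ring. rewrite Cmod_0 in Hz. lra.
  - intros Hne. apply H. split; trivial. apply Cmod_gt_0.
    intros E. exact (Hne (Cminus_eq_0 _ _ E)).
Qed.

Lemma locally'_and (z0 : C) (P Q : C -> Prop) :
  locally' z0 P -> locally' z0 Q -> locally' z0 (fun z => P z /\ Q z).
Proof. intros HP HQ. exact (filter_and _ _ HP HQ). Qed.

Lemma locally'_imp (z0 : C) (P Q : C -> Prop) :
  (forall z, P z -> Q z) -> locally' z0 P -> locally' z0 Q.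
Proof. intros H. exact (filter_imp P Q H). Qed.

Lemma locally'_shift (z0 c : C) (P : C -> Prop) :
  locally' (z0 + c) P -> locally' z0 (fun z => P (z + c)).
Proof.
  rewrite !locally'_Cmod. intros [r [Hr H]]. exists r; split; trivial.
  intros z Hz. apply H. now replace (z + c - (z0 + c)) with (z - z0) by ring.
Qed.

Lemma locally'_proper (z0 : C) (P : C -> Prop) :
  locally' z0 P -> exists z, P z.
Proof.
  rewrite locally'_Cmod. intros [r [Hr H]]. exists (z0 + RtoC (r / 2)).
  apply H. replace (z0 + RtoC (r / 2) - z0) with (RtoC (r / 2)) by ring.
  rewrite Cmod_R, Rabs_pos_eq; lra.
Qed.

Lemma open_locally' (P : C -> Prop) : open (fun z : C => locally' z P).
Proof.
  intros z0. rewrite locally'_Cmod, locally_Cmod. intros [r [Hr H]].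
  exists r; split; trivial. intros z1 Hz1.
  destruct (Ceq_dec z1 z0) as [->|Hne].
  - apply locally'_Cmod. now exists r.
  - assert (Hd : (0 < Cmod (z1 - z0))%R).
    { apply Cmod_gt_0. intros E. exact (Hne (Cminus_eq_0 _ _ E)). }
    apply locally'_Cmod.
    (* The first bound keeps [z] away from [z0], where [P] may fail; the second keeps it inside the
       disc of radius [r]. *)
    exists (Rmin (Cmod (z1 - z0)) (r - Cmod (z1 - z0))). split.
    + apply Rmin_pos; lra.
    + intros z [_ Hz]. apply H.
      pose proof (Rmin_l (Cmod (z1 - z0)) (r - Cmod (z1 - z0))).
      pose proof (Rmin_r (Cmod (z1 - z0)) (r - Cmod (z1 - z0))).
      pose proof (Cmod_triangle (z - z1) (z1 - z0)) as T1.
      replace (z - z1 + (z1 - z0)) with (z - z0) in T1 by ring.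
      pose proof (Cmod_triangle (z - z0) (- (z - z1))) as T2.
      replace (z - z0 + - (z - z1)) with (z1 - z0) in T2 by ring.
      rewrite Cmod_opp in T2. lra.
Qed.

(** Follow the segment [g] from a point of [P] to [z0] and take the supremum [T] of the parameters
    up to which it stays in [P]: openness of [P] and of [Q] forces [T = 1] and [P (g 1)]. *)
Lemma C_connected (P Q : C -> Prop) :
  @open C_UniformSpace P -> @open C_UniformSpace Q ->
  (forall z, P z \/ Q z) -> (forall z, P z -> ~ Q z) ->
  (exists z, P z) -> forall z, P z.
Proof.
  intros oP oQ cover disj [z1 Hz1] z0.
  set (g := fun t : R => z1 + RtoC t * (z0 - z1)).
  assert (near : forall (D : C -> Prop) t, @open C_UniformSpace D -> D (g t) ->
            exists d : R, (0 < d)%R /\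
              forall s, (Rabs (s - t) < d)%R -> D (g s)).
  { intros D t oD Dt. apply oD in Dt. apply locally_Cmod in Dt.
    destruct Dt as [r [Hr H]].
    pose proof (Cmod_ge_0 (z0 - z1)) as Hc.
    (* The [+ 1] keeps the divisor positive even if [z0 = z1]. *)
    exists (r / (Cmod (z0 - z1) + 1))%R. split.
    - apply Rdiv_lt_0_compat; lra.
    - intros s Hs. apply H. unfold g.
      replace (z1 + RtoC s * (z0 - z1) - (z1 + RtoC t * (z0 - z1)))
        with (RtoC (s - t) * (z0 - z1)) by (rewrite RtoC_minus; ring).
      rewrite Cmod_mult, Cmod_R.
      apply (Rmult_lt_compat_r (Cmod (z0 - z1) + 1)) in Hs; [|lra].
      replace (r / (Cmod (z0 - z1) + 1) * (Cmod (z0 - z1) + 1))%R with r in Hs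
        by (field; lra).
      pose proof (Rabs_pos (s - t)). lra. }
  set (S := fun t => (0 <= t <= 1)%R /\ forall s, (0 <= s <= t)%R -> P (g s)).
  destruct (completeness S) as [T [ub lub]].
  { exists 1%R. intros t [Ht _]. lra. }
  { exists 0%R. split; [lra|]. intros s Hs. replace s with 0%R by lra.
    unfold g. replace (z1 + RtoC 0 * (z0 - z1)) with z1 by ring. exact Hz1. }
  assert (HT0 : (0 <= T)%R).
  { apply ub. split; [lra|]. intros s Hs. replace s with 0%R by lra.
    unfold g. replace (z1 + RtoC 0 * (z0 - z1)) with z1 by ring. exact Hz1. }
  assert (HT1 : (T <= 1)%R). { apply lub. intros t [Ht _]. lra. }
  assert (app : forall d, (0 < d)%R -> exists t, S t /\ (T - d < t <= T)%R).
  { intros d Hd. apply NNPP. intros N. assert (T <= T - d)%R; [|lra].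
    apply lub. intros t St. destruct (Rle_lt_dec t (T - d)); trivial.
    exfalso. apply N. exists t. split; trivial. split; trivial. now apply ub. }
  destruct (cover (g T)) as [PT|QT].
  - destruct (near P T oP PT) as [d [Hd H]].
    assert (ST : forall s, (0 <= s < T + d)%R -> P (g s)).
    { intros s Hs. destruct (Rlt_le_dec s T) as [l|l].
      - destruct (app (T - s)%R) as [t [[_ Ht] Ht']]; [lra|]. apply Ht. lra.
      - apply H. rewrite Rabs_pos_eq; lra. }
    destruct (Req_dec T 1) as [->|n].
    + replace z0 with (g 1%R) by (unfold g; ring). exact PT.
    (* For [T < 1] this minimum lies in [S] and exceeds its upper bound [T]. *)
    + exfalso. assert (Rmin 1 (T + d / 2) <= T)%R.
      { apply ub. pose proof (Rmin_l 1 (T + d / 2)).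
        pose proof (Rmin_r 1 (T + d / 2)).
        split; [split; trivial; apply Rmin_glb; lra|].
        intros s Hs. apply ST. lra. }
      revert H0. unfold Rmin. destruct Rle_dec; lra.
  (* Some [t] in [S] is so close to [T] that [g t] lies in both [P] and [Q]. *)
  - destruct (near Q T oQ QT) as [d [Hd H]].
    destruct (app d Hd) as [t [[Ht Pt] Ht']]. exfalso.
    apply (disj (g t)); [apply Pt; lra|]. apply H.
    rewrite Rabs_minus_sym, Rabs_pos_eq; lra.
Qed.

(** * Power series estimates and isolated zeros *)

(** Convergent partial sums are bounded by some [M], and each term after the first is a difference
    of two consecutive ones, whence [2 * M]. *)
Lemma is_pseries_C_terms_bounded (a : nat -> C) (w l : C) :
  is_pseries a w l ->
  exists M : R, forall k, (Cmod (a k) * Cmod w ^ k <= M)%R.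
Proof.
  intros H. destruct (filterlim_bounded _ (ex_intro _ l H)) as [M HM].
  assert (HM' : forall n, (Cmod (sum_n (fun k => scal (pow_n w k) (a k)) n) <= M)%R)
    by exact HM.
  assert (tri : forall s x : C, (Cmod x <= Cmod (s + x) + Cmod s)%R).
  { intros s x. replace x with (s + x + - s) at 1 by ring.
    rewrite <- (Cmod_opp s). apply Cmod_triangle. }
  exists (2 * M)%R. intros k. rewrite <- Cmod_pow, <- Cmod_mult.
  replace (a k * w ^ k) with (scal (pow_n w k) (a k))
    by (change (@eq C (w ^ k * a k) (a k * w ^ k)); ring).
  pose proof (HM' 0%nat) as H0.
  pose proof (Cmod_ge_0 (sum_n (fun k => scal (pow_n w k) (a k)) 0)) as H1.
  destruct k as [|k].
  - rewrite sum_O in H0, H1. lra.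
  - pose proof (HM' k) as HA. pose proof (HM' (S k)) as HB.
    rewrite sum_Sn in HB.
    eapply Rle_trans; [apply (tri (sum_n (fun k => scal (pow_n w k) (a k)) k))|].
    replace (2 * M)%R with (M + M)%R by ring.
    exact (Rplus_le_compat _ _ _ _ HB HA).
Qed.

Lemma is_pseries_C_lim (a : nat -> C) (w l : C) (eps : R) :
  is_pseries a w l -> (0 < eps)%R ->
  exists n0, forall n, (n0 <= n)%nat ->
    (Cmod (sum_n (fun k => scal (pow_n w k) (a k)) n - l) < eps)%R.
Proof.
  intros H He.
  exact (proj1 (filterlim_locally_ball_norm _ l) H (mkposreal eps He)).
Qed.

(** The terms beyond [N] are dominated by [M * t ^ k] with [t = Cmod w / rho <= 1 / 2], and such a
    geometric tail is at most twice its first term. *)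
Lemma pseries_leading_term (a : nat -> C) (N : nat) (rho M : R) (w l : C) :
  (0 < rho)%R -> (forall k, Cmod (a k) * rho ^ k <= M)%R ->
  (forall k, (k < N)%nat -> a k = 0) ->
  (Cmod w <= rho / 2)%R -> is_pseries a w l ->
  (Cmod (l - a N * w ^ N) <= 2 * M * (Cmod w / rho) ^ S N)%R.
Proof.
  intros Hrho HM Ha Hw Hl.
  set (t := (Cmod w / rho)%R).
  pose proof (Cmod_ge_0 w) as Hw0.
  assert (Ht : (0 <= t <= 1 / 2)%R).
  { unfold t. split.
    - apply Rmult_le_pos; [lra|]. left. now apply Rinv_0_lt_compat.
    - apply (Rmult_le_reg_r rho); [lra|]. field_simplify; lra. }
  assert (HM0 : (0 <= M)%R).
  { eapply Rle_trans; [|apply (HM 0%nat)]. simpl.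
    pose proof (Cmod_ge_0 (a 0%nat)). lra. }
  assert (Hterm : forall k, (Cmod (w ^ k * a k) <= M * t ^ k)%R).
  { intros k. rewrite Cmod_mult, Cmod_pow.
    replace (Cmod w) with (t * rho)%R by (unfold t; field; lra).
    rewrite Rpow_mult_distr.
    replace (t ^ k * rho ^ k * Cmod (a k))%R
      with ((Cmod (a k) * rho ^ k) * t ^ k)%R by ring.
    apply Rmult_le_compat_r; trivial. apply pow_le; lra. }
  set (s := sum_n (fun k => scal (pow_n w k) (a k)) : nat -> C).
  assert (rec : forall n, s (S n) = s n + w ^ S n * a (S n)).
  { intros n. unfold s. rewrite sum_Sn. reflexivity. }
  assert (low : forall n, (n < N)%nat -> s n = 0).
  { induction n as [|n IH]; intros Hn.
    - unfold s. rewrite sum_O. rewrite (Ha 0%nat Hn).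
      change (@eq C (w ^ 0 * 0) (0)). ring.
    - rewrite rec, IH, (Ha (S n)) by lia. ring. }
  assert (atN : s N = a N * w ^ N).
  { destruct N as [|N].
    - unfold s. rewrite sum_O. change (@eq C (w ^ 0 * a 0%nat) (a 0%nat * w ^ 0)). ring.
    - rewrite rec, low by lia. ring. }
  (* [1 + t + ... + t^n <= 2 - t^n] for [0 <= t <= 1/2]. *)
  assert (high : forall n, (Cmod (s (S N + n)%nat - a N * w ^ N)
                      <= M * t ^ S N * (2 - t ^ n))%R).
  { induction n as [|n IH].
    - rewrite Nat.add_0_r, rec, atN.
      replace (a N * w ^ N + w ^ S N * a (S N) - a N * w ^ N)
        with (w ^ S N * a (S N)) by ring.
      eapply Rle_trans; [apply Hterm|]. simpl. lra.
    - rewrite <- plus_n_Sm, rec.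
      replace (s (S N + n)%nat + w ^ S (S N + n) * a (S (S N + n)) - a N * w ^ N)
        with (s (S N + n)%nat - a N * w ^ N + w ^ S (S N + n) * a (S (S N + n)))
        by ring.
      eapply Rle_trans; [apply Cmod_triangle|].
      pose proof (Hterm (S (S N + n))) as H.
      replace (t ^ S (S N + n))%R with (t ^ S N * t ^ S n)%R in H
        by (rewrite <- pow_add; f_equal; lia).
      assert (Hn : (t ^ S n <= t ^ n / 2)%R).
      { simpl. pose proof (pow_le t n (proj1 Ht)). nra. }
      assert (0 <= M * t ^ S N)%R
        by (apply Rmult_le_pos; trivial; apply pow_le; lra).
      nra. }
  (* Pass to the limit: if the bound failed, the excess would serve as [eps], and a late partial sum
     would contradict [high]. *)
  apply Rnot_lt_le. intros Hlt.
  destruct (is_pseries_C_lim a w l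
    (Cmod (l - a N * w ^ N) - 2 * M * t ^ S N)%R Hl) as [n0 Hn0]; [lra|].
  specialize (Hn0 (S N + n0)%nat ltac:(lia)). fold s in Hn0.
  specialize (high n0).
  assert (0 <= M * t ^ S N * t ^ n0)%R
    by (apply Rmult_le_pos; [apply Rmult_le_pos; trivial|]; apply pow_le; lra).
  pose proof (Cmod_triangle (s (S N + n0)%nat - a N * w ^ N)
                (- (s (S N + n0)%nat - l))) as T.
  rewrite Cmod_opp in T.
  replace (s (S N + n0)%nat - a N * w ^ N + - (s (S N + n0)%nat - l))
    with (l - a N * w ^ N) in T by ring.
  lra.
Qed.

(** Either all Laurent coefficients vanish, or the first nonzero term [a N * (z - z0) ^ N] dominates
    the rest close to [z0]. *)
Lemma meromorphic_isolated_zeros (u : C -> C) (z0 : C) :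
  meromorphic_at u z0 ->
  locally' z0 (fun z => u z = 0) \/ locally' z0 (fun z => u z <> 0).
Proof.
  intros [n [a Hu]]. apply locally'_Cmod in Hu. destruct Hu as [r [Hr Hu]].
  destruct (classic (exists k, a k <> 0)) as [Hex|Hnone].
  - right.
    assert (HN : exists N, a N <> 0 /\ forall k, (k < N)%nat -> a k = 0).
    { destruct Hex as [k Hk]. revert Hk.
      induction k as [k IH] using lt_wf_ind. intros Hk.
      destruct (classic (exists j, (j < k)%nat /\ a j <> 0)) as [[j [Hj Hj']]|Hno].
      - now apply (IH j).
      - exists k. split; trivial. intros j Hj. apply NNPP. intros N. apply Hno.
        now exists j. }
    destruct HN as [N [HaN Hlow]].
    (* The expansion is valid at [z0 + rho], inside the punctured disc; convergence there bounds the
       coefficients. *)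
    set (rho := (r / 2)%R).
    destruct (is_pseries_C_terms_bounded a (RtoC rho)
       (((z0 + RtoC rho) - z0) ^ n * u (z0 + RtoC rho))) as [M HM].
    { replace (RtoC rho) with (z0 + RtoC rho - z0) at 1 by ring. apply Hu.
      replace (z0 + RtoC rho - z0) with (RtoC rho) by ring.
      rewrite Cmod_R, Rabs_pos_eq; unfold rho; lra. }
    rewrite Cmod_R, Rabs_pos_eq in HM by (unfold rho; lra).
    assert (Hrho : (0 < rho)%R) by (unfold rho; lra).
    assert (HM0 : (0 <= M)%R).
    { eapply Rle_trans; [|apply (HM 0%nat)]. simpl.
      pose proof (Cmod_ge_0 (a 0%nat)). lra. }
    apply Cmod_gt_0 in HaN.
    assert (HaNr : (0 < Cmod (a N) * rho ^ S N)%R)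
      by (apply Rmult_lt_0_compat; trivial; now apply pow_lt).
    apply locally'_Cmod.
    (* The first bound is what [pseries_leading_term] requires; the second contradicts [L2] below.
       The [+ 1] keeps the divisor positive when [M = 0]. *)
    exists (Rmin (rho / 2) (Cmod (a N) * rho ^ S N / (2 * M + 1)))%R. split.
    { apply Rmin_pos; [lra|]. apply Rdiv_lt_0_compat; lra. }
    intros z [Hz0 Hz] Huz.
    pose proof (Rmin_l (rho / 2) (Cmod (a N) * rho ^ S N / (2 * M + 1))) as m1.
    pose proof (Rmin_r (rho / 2) (Cmod (a N) * rho ^ S N / (2 * M + 1))) as m2.
    pose proof (pseries_leading_term a N rho M (z - z0) ((z - z0) ^ n * u z)
      Hrho HM Hlow ltac:(lra) ltac:(apply Hu; unfold rho in *; lra)) as L.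
    rewrite Huz in L.
    replace ((z - z0) ^ n * 0 - a N * (z - z0) ^ N)
      with (- (a N * (z - z0) ^ N)) in L by ring.
    rewrite Cmod_opp, Cmod_mult, Cmod_pow in L.
    set (x := Cmod (z - z0)) in *.
    unfold Rdiv in L at 1. rewrite Rpow_mult_distr, pow_inv in L.
    assert (Hx : (0 < x ^ N)%R) by now apply pow_lt.
    assert (Hp : (0 < rho ^ S N)%R) by now apply pow_lt.
    (* This is [L] with the common factor [x ^ N / rho ^ S N] cancelled. *)
    assert (L2 : (Cmod (a N) * rho ^ S N <= 2 * M * x)%R).
    { apply (Rmult_le_reg_r (x ^ N * / rho ^ S N)).
      - apply Rmult_lt_0_compat; trivial. now apply Rinv_0_lt_compat.
      - replace (Cmod (a N) * rho ^ S N * (x ^ N * / rho ^ S N))%R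
          with (Cmod (a N) * x ^ N)%R by (field; lra).
        replace (2 * M * x * (x ^ N * / rho ^ S N))%R
          with (2 * M * (x ^ S N * / rho ^ S N))%R by (simpl (x ^ S N)%R; ring).
        exact L. }
    assert (x * (2 * M + 1) < Cmod (a N) * rho ^ S N)%R.
    { apply (Rlt_div_r x); lra. }
    lra.
  - left. apply locally'_Cmod. exists r. split; trivial. intros z Hz.
    assert (Hzero : (z - z0) ^ n * u z = 0).
    { apply Cmod_eq_0. apply Rle_antisym; [|apply Cmod_ge_0].
      apply Rnot_lt_le. intros Hpos.
      destruct (is_pseries_C_lim _ _ _ _ (Hu z Hz) Hpos) as [n0 Hn0].
      specialize (Hn0 n0 (le_n _)).
      rewrite (sum_n_ext _ (fun _ => RtoC 0)) in Hn0.
      2:{ intros k. replace (a k) with (RtoC 0).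
          - change (@eq C ((z - z0) ^ k * 0) (0)). ring.
          - symmetry. apply NNPP. intros H. apply Hnone. now exists k. }
      replace (sum_n (fun _ : nat => RtoC 0) n0) with (RtoC 0) in Hn0.
      2:{ symmetry. clear. induction n0 as [|m IH].
          - now rewrite sum_O.
          - rewrite sum_Sn, IH. change (@eq C (0 + 0) (RtoC 0)). ring. }
      replace (0 - (z - z0) ^ n * u z) with (- ((z - z0) ^ n * u z)) in Hn0 by ring.
      rewrite Cmod_opp in Hn0. lra. }
    assert (Hne : (z - z0) ^ n <> 0).
    { apply Cpow_nz. apply Cmod_gt_0. lra. }
    destruct (Ceq_dec (u z) 0) as [E|E]; trivial.
    exfalso. now apply (Cmult_neq_0 _ _ Hne E).
Qed.

(** The points near which [u] vanishes and those near which it does not form two disjoint open sets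
    covering the plane, so connectedness leaves only one of them. *)
Lemma meromorphic_identity (u : C -> C) :
  meromorphic u -> ~ mero_eq u (fun _ => 0) ->
  forall z0, locally' z0 (fun z => u z <> 0).
Proof.
  intros Hu Hne.
  apply (C_connected _ (fun z0 => locally' z0 (fun z => u z = 0))).
  - apply open_locally'.
  - apply open_locally'.
  - intros z. destruct (meromorphic_isolated_zeros u z (Hu z)); tauto.
  - intros z H1 H2.
    destruct (locally'_proper _ _ (locally'_and _ _ _ H1 H2)) as [w Hw]. tauto.
  - apply NNPP. intros Hno. apply Hne. intros z0.
    destruct (meromorphic_isolated_zeros u z0 (Hu z0)) as [H|H]; trivial.
    exfalso. apply Hno. now exists z0.
Qed.

(** * From the quadratic to the linear difference equation *)

(** The common pole order [n + m] serves both functions: the extra powers of [z - z0] shift the two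
    coefficient sequences by [m] and [n]. *)
Lemma meromorphic_minus (f g : C -> C) :
  meromorphic f -> meromorphic g -> meromorphic (fun z => f z - g z).
Proof.
  intros Hf Hg z0. destruct (Hf z0) as [n [a Ha]], (Hg z0) as [m [b Hb]].
  exists (n + m)%nat, (PS_minus (PS_incr_n a m) (PS_incr_n b n)).
  generalize (locally'_and _ _ _ Ha Hb). apply locally'_imp. intros z [H1 H2].
  apply (is_pseries_incr_n a m) in H1. apply (is_pseries_incr_n b n) in H2.
  pose proof (is_pseries_minus _ _ _ _ _ H1 H2) as H.
  replace ((z - z0) ^ (n + m) * (f z - g z))
    with ((z - z0) ^ m * ((z - z0) ^ n * f z) - (z - z0) ^ n * ((z - z0) ^ m * g z))
    by (rewrite Cpow_add_r; ring).
  exact H.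
Qed.

Lemma meromorphic_shift (f : C -> C) (c : C) :
  meromorphic f -> meromorphic (fun z => f (z + c)).
Proof.
  intros Hf z0. destruct (Hf (z0 + c)) as [n [a Ha]]. exists n, a.
  apply locally'_shift in Ha. revert Ha. apply locally'_imp. intros z.
  now replace (z + c - (z0 + c)) with (z - z0) by ring.
Qed.

Lemma solution_linear (A B f : C -> C) :
  meromorphic f -> periodic 1 A -> periodic 1 B -> solution A B f ->
  ~ periodic 2 f ->
  mero_eq (fun z => f (z + 1 + 1)) (fun z => (A z + 2) * f (z + 1) - f z).
Proof.
  intros Hf pA pB sol np z0.
  assert (E2 : forall z : C, z + 2 = z + 1 + 1) by (intros z; ring).
  assert (Hne : locally' z0 (fun z => f (z + 2) - f z <> 0)).
  { apply meromorphic_identity.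
    - apply (meromorphic_minus (fun z => f (z + 2)) f); trivial.
      now apply meromorphic_shift.
    - intros H. apply np. intros z1. generalize (H z1). apply locally'_imp.
      intros z. apply Cminus_eq_0. }
  generalize (locally'_and _ _ _ Hne (locally'_and _ _ _ (pA z0)
    (locally'_and _ _ _ (pB z0) (locally'_and _ _ _ (sol z0)
      (locally'_shift _ _ _ (sol (z0 + 1))))))).
  apply locally'_imp. intros z [N [EA [EB [S0 S1]]]].
  unfold Defs.Delta in S0, S1.
  rewrite E2 in N. rewrite EA, EB in S1.
  apply Cminus_eq_0.
  destruct (Ceq_dec (f (z + 1 + 1) - ((A z + 2) * f (z + 1) - f z)) 0) as [E|E];
    trivial.
  exfalso. apply (Cmult_neq_0 _ _ N E).
  (* The product of the two factors is the shifted equation minus the original one; [B] cancels by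
     periodicity. *)
  transitivity (((f (z + 1 + 1) - f (z + 1)) ^ 2 - (f (z + 1) - f z) ^ 2)
     - A z * f (z + 1) * (f (z + 1 + 1) - f z)); [ring|].
  rewrite S0, S1. ring.
Qed.

(** * Elimination and the algebraic relation *)

(** Pointwise form of the relation: [x'] and [y'] stand for the values of the two solutions at
    [z + 1]. *)
Lemma casoratian_identity (A B x x' y y' : C) :
  (x' - x) ^ 2 = A * (x * x' - B) -> (y' - y) ^ 2 = A * (y * y' - B) ->
  let H := x * (y' - y) - y * (x' - x) in
  A * ((A + 4) * x ^ 2 * y ^ 2 - 2 * B * (x ^ 2 + y ^ 2)) * H ^ 2
    - (A * B * (x ^ 2 - y ^ 2)) ^ 2 = H ^ 4.
Proof.
  intros Ex Ey H.
  set (qx := (x' - x) ^ 2 - A * (x * x' - B)).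
  set (qy := (y' - y) ^ 2 - A * (y * y' - B)).
  assert (Zx : qx = 0) by (unfold qx; rewrite Ex; ring).
  assert (Zy : qy = 0) by (unfold qy; rewrite Ey; ring).
  set (S := y * x' + x * y').
  (* With [x' y = (S - H) / 2] and [x y' = (S + H) / 2], the difference and the
     sum of the two equations are linear and quadratic in [S]: eliminate [S]. *)
  assert (E1 : H * S = (A + 2) * (x * y) * H - A * B * (x ^ 2 - y ^ 2)).
  { apply Cminus_eq_0. transitivity (x ^ 2 * qy - y ^ 2 * qx).
    - unfold H, S, qx, qy. ring.
    - rewrite Zx, Zy. ring. }
  assert (E2 : 4 * (x * y) ^ 2 + S ^ 2 + H ^ 2 - 2 * (A + 2) * (x * y) * S
               + 2 * A * B * (x ^ 2 + y ^ 2) = 0).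
  { transitivity (2 * (x ^ 2 * qy + y ^ 2 * qx)).
    - unfold H, S, qx, qy. ring.
    - rewrite Zx, Zy. ring. }
  symmetry. apply Cminus_eq_0.
  clearbody H S. clear - E1 E2.
  (* Multiplying [E2] by [H ^ 2] makes [S] occur only through [H * S]; completing the square in it
     produces the square of [E1]. *)
  transitivity (H ^ 2 * (4 * (x * y) ^ 2 + S ^ 2 + H ^ 2
      - 2 * (A + 2) * (x * y) * S + 2 * A * B * (x ^ 2 + y ^ 2))
    - ((H * S - (A + 2) * (x * y) * H) ^ 2 - (A * B * (x ^ 2 - y ^ 2)) ^ 2)).
  - ring.
  - rewrite E1, E2. ring.
Qed.

Theorem theorem4p3
  (A B f1 f2 : C -> C)
  (hA : meromorphic A) (hB : meromorphic B)
  (pA : periodic 1 A) (pB : periodic 1 B)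
  (hf1 : meromorphic f1) (hf2 : meromorphic f2)
  (tf1 : transcendental f1) (tf2 : transcendental f2)
  (distinct : ~ mero_eq f1 f2)
  (sol1 : solution A B f1) (sol2 : solution A B f2)
  (np1 : ~ periodic 2 f1) (np2 : ~ periodic 2 f2) :
  let H := casoratian f1 f2 in
  periodic 1 H /\
  mero_eq
    (fun z =>
       A z * ((A z + 4) * f1 z ^ 2 * f2 z ^ 2
              - 2 * B z * (f1 z ^ 2 + f2 z ^ 2)) * H z ^ 2
       - (A z * B z * (f1 z ^ 2 - f2 z ^ 2)) ^ 2)
    (fun z => H z ^ 4) /\
  (* the coefficients, in the displayed grouping: f1^2 f2^2, f1^2 + f2^2,
     (f1^2 - f2^2)^2 and the constant term *)
  periodic 1 (fun z => A z * (A z + 4) * H z ^ 2) /\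
  periodic 1 (fun z => - (2 * A z * B z * H z ^ 2)) /\
  periodic 1 (fun z => - (A z * B z) ^ 2) /\
  periodic 1 (fun z => H z ^ 4).
Proof.
  intros H.
  assert (pH : periodic 1 H).
  { intros z0.
    generalize (locally'_and _ _ _
      (solution_linear A B f1 hf1 pA pB sol1 np1 z0)
      (solution_linear A B f2 hf2 pA pB sol2 np2 z0)).
    apply locally'_imp. intros z [L1 L2].
    (* Both solutions share the coefficient [A z + 2], so its contributions to [H (z + 1)]
       cancel. *)
    unfold H, casoratian, Defs.Delta. rewrite L1, L2. ring. }
  split; [exact pH|]. split.
  { intros z0. generalize (locally'_and _ _ _ (sol1 z0) (sol2 z0)).
    apply locally'_imp. intros z [S1 S2].
    exact (casoratian_identity _ _ _ _ _ _ S1 S2). }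
  assert (per : forall z0, locally' z0 (fun z =>
            A (z + 1) = A z /\ B (z + 1) = B z /\ H (z + 1) = H z)).
  { intros z0. repeat apply locally'_and; [apply pA|apply pB|apply pH]. }
  repeat split; intros z0; generalize (per z0); apply locally'_imp;
    intros z [EA [EB EH]]; now rewrite ?EA, ?EB, ?EH.
Qed.
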